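(* Let either $E=\ell^p(\mathbb{R})$ for some $1\le p<\infty$ or $E=c_0(\mathbb{R})$, and let $(T_t)_{t\in(0,\infty)}$ be a positive semigroup on $E$ such that $t\mapsto T_tf$ is continuous on $(0,\infty)$ for all $f\in E$. Then the following assertions hold: (a) For each $f\in E$ the set $\{r\in\mathbb{R}: |T_tf|(r)>0 \text{ for some } t>0\}$ is at most countable. (b) For all $r,s\in\mathbb{R}$, either $(T_te^r)(s)>0$ for all $t>0$, or $(T_te^r)(s)=0$ for all $t>0$.
   Context: Here $\ell^p(\mathbb{R})$ is the space of all $p$-summable functions $f\colon\mathbb{R}\to\mathbb{R}$ over the (uncountable, discrete) index set $\mathbb{R}$, i.e. those with $\sum_{r\in\mathbb{R}}|f(r)|^p<\infty$, with its usual norm, and $c_0(\mathbb{R})=\{f\colon\mathbb{R}\to\mathbb{R}: \text{for all }\varepsilon>0 \text{ the set } \{r\in\mathbb{R}:|f(r)|>\varepsilon\} \text{ is finite}\}$ endowed with the sup norm. Both carry the pointwise ordering. For $r\in\mathbb{R}$, $e^r=\mathbf{1}_{\{r\}}$ denotes the indicator function of the singleton $\{r\}$. A family of linear operators $(T_t)_{t\in(0,\infty)}$ on a vector space is a (one-parameter operator) semigroup if $T_{t+s}=T_tT_s$ for all $t,s>0$; it is positive if every $T_t$ maps the positive cone (pointwise nonnegative elements) into itself. Continuity of $t\mapsto T_tf$ is with respect to the norm of $E$. *)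

(* Defs.v *)
From HB Require Import structures.
From mathcomp Require Import all_boot all_order all_algebra.
From mathcomp Require Import all_classical all_reals all_analysis.
From mathcomp Require Import ring lra.

Set Implicit Arguments.
Unset Strict Implicit.
Unset Printing Implicit Defensive.

Import Order.TTheory GRing.Theory Num.Theory.
Import numFieldNormedType.Exports.

Local Open Scope classical_set_scope.
Local Open Scope ring_scope.

Section esum_extra.
Context {R : realType} {T : choiceType}.
Implicit Types (a : T -> \bar R) (f g : T -> R).
Local Open Scope ereal_scope.

Lemma le_esumZ a (c : R) : (0 <= c)%R -> (forall t, 0 <= a t) ->
  \esum_(t in setT) (c%:E * a t) <= c%:E * \esum_(t in setT) a t.
Proof.
move=> c0 a0; apply: ge_ereal_sup => _ [X [finX XT]] <-.
rewrite -ge0_mule_fsumr//; apply: lee_wpmul2l; first by rewrite lee_fin.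
by apply: esum_ge; exists X.
Qed.

Lemma esumZ a (c : R) : (0 <= c)%R -> (forall t, 0 <= a t) ->
  \esum_(t in setT) (c%:E * a t) = c%:E * \esum_(t in setT) a t.
Proof.
move=> c0 a0; apply/eqP; rewrite eq_le le_esumZ//=.
have [->|cn0] := eqVneq c 0%R.
  by rewrite mul0e; apply: esum_ge0 => t _; rewrite mul0e.
have ca0 t : 0 <= c%:E * a t by rewrite mule_ge0 ?lee_fin.
have := @le_esumZ (fun t => c%:E * a t) c^-1 _ ca0.
rewrite invr_ge0 => /(_ c0).
under eq_esum do rewrite muleA -EFinM mulVf// mul1e.
move=> /(@lee_wpmul2l _ c%:E); rewrite lee_fin => /(_ c0).
by rewrite muleA -EFinM divff// mul1e.
Qed.

End esum_extra.

Lemma powR_abs_conv {R : realType} (p t x y : R) : 1 <= p -> 0 <= t <= 1 ->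
  `|t * x + (1 - t) * y| `^ p <= t * `|x| `^ p + (1 - t) * `|y| `^ p.
Proof.
move=> p1 /andP[t0 t1].
have s0 : 0 <= 1 - t by rewrite subr_ge0.
apply: (@le_trans _ _ ((t * `|x| + (1 - t) * `|y|) `^ p)).
  have p0 : 0 <= p by exact: le_trans p1.
  rewrite ge0_ler_powR ?nnegrE ?addr_ge0 ?mulr_ge0//.
  by rewrite (le_trans (ler_normD _ _))// !normrM (ger0_norm t0) (ger0_norm s0).
have := @convex_powR R p p1 (Itv01 t0 t1) `|x| `|y|.
rewrite !inE /= !in_itv/= !normr_ge0 => /(_ isT isT).
by rewrite !convRE.
Qed.

(* The spaces of functions R -> R under consideration, indexed by the discrete
   set R: [ell p] stands for l^p(R), 1 <= p < +oo, and [c0] for c_0(R). The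
   elements of the space S form the normed module [vec S]. *)
Variant fspace (R : realType) : Type := ell p of 1 <= p :> R | c0.
Arguments c0 {R}.

Section fspace.
Context {R : realType}.
Implicit Types (p : R) (S : fspace R) (f g : R -> R).

Definition ell_sum p f : \bar R := \esum_(r in [set: R]) (`|f r| `^ p)%:E.

Definition in_fspace S : {pred R -> R} :=
  match S with
  | ell p _ => [pred f | (ell_sum p f < +oo)%E]
  | c0 => [pred f | `[< forall eps, 0 < eps ->
                        finite_set [set r | `|f r| > eps] >]]
  end.

Lemma in_ellE p (p1 : 1 <= p) f :
  (f \in in_fspace (ell p1)) = (ell_sum p f < +oo)%E.
Proof. by []. Qed.

Lemma in_c0P f :
  reflect (forall eps, 0 < eps -> finite_set [set r | `|f r| > eps])
          (f \in in_fspace c0).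
Proof. exact: asboolP. Qed.

Definition fspace_norm S f : R :=
  match S with
  | ell p _ => fine (ell_sum p f) `^ p^-1
  | c0 => sup [set `|f r| | r in [set: R]]
  end.

Lemma ell_sum_ge0 p f : (0 <= ell_sum p f)%E.
Proof. by apply: esum_ge0 => r _; rewrite lee_fin powR_ge0. Qed.

Lemma ell_sum_fin p f : (ell_sum p f < +oo)%E ->
  ell_sum p f = (fine (ell_sum p f))%:E.
Proof. by move=> ?; rewrite fineK// ge0_fin_numE ?ell_sum_ge0. Qed.

Lemma ell_sumZ p (c : R) f :
  ell_sum p (c *: f) = ((`|c| `^ p)%:E * ell_sum p f)%E.
Proof.
rewrite /ell_sum -esumZ ?powR_ge0//.
by apply: eq_esum => r _; rewrite /= -EFinM -powRM// -normrM.
Qed.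

Lemma ell_sum_conv p (t : R) f g : 1 <= p -> 0 <= t <= 1 ->
  (ell_sum p (t *: f + (1 - t) *: g)%R <=
   t%:E * ell_sum p f + (1 - t)%:E * ell_sum p g)%E.
Proof.
move=> p1 t01; have /andP[t0 t1] := t01.
have s0 : 0 <= 1 - t by rewrite subr_ge0.
rewrite /ell_sum -!esumZ//.
rewrite -esumD => [|r _|r _]; last 2 first.
- by rewrite -EFinM lee_fin mulr_ge0// powR_ge0.
- by rewrite -EFinM lee_fin mulr_ge0// powR_ge0.
by apply: le_esum => r _; rewrite -!EFinM -EFinD lee_fin; exact: powR_abs_conv.
Qed.

Lemma ell_sum_eq0 p f : 1 <= p -> ell_sum p f = 0%E -> f = 0.
Proof.
move=> p1 f0; apply/funext => r.
have : ((`|f r| `^ p)%:E <= ell_sum p f)%E.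
  apply: esum_ge; exists [set r]; last by rewrite fsbig_set1.
  by split => //; exact: finite_set1.
rewrite f0 lee_fin => fr0.
have /powR_eq0_eq0/normr0_eq0 // : `|f r| `^ p = 0.
by apply/eqP; rewrite eq_le fr0 powR_ge0.
Qed.

Lemma ell_sum0 p : 1 <= p -> ell_sum p 0 = 0%E.
Proof.
move=> p1; apply: esum1 => r _ /=.
by rewrite normr0 powR0// gt_eqF// (lt_le_trans ltr01).
Qed.

Lemma ell_sum_indic p r0 : 1 <= p -> (ell_sum p \1_[set r0] < +oo)%E.
Proof.
move=> p1; have p0 : p != 0 by rewrite gt_eqF// (lt_le_trans ltr01).
rewrite (@le_lt_trans _ _ 1%E) ?ltry//.
have -> : ell_sum p \1_[set r0] =
    (\esum_(r in [set r0]) (1 : \bar R))%E.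
  rewrite [RHS]esum_mkcond; apply: eq_esum => r _.
  by rewrite indicE; case: ifPn => /= _; rewrite ?normr1 ?powR1 ?normr0 ?powR0.
by rewrite esum_set1// lee_fin.
Qed.

Lemma in_fspace_submod_closed S : submod_closed (in_fspace S).
Proof.
case: S => [p p1|]; split.
- by rewrite in_ellE ell_sum0.
- move=> a f g; rewrite !in_ellE => foo goo.
  have -> : a *: f + g = (2^-1 : R) *: ((2 * a) *: f) + (1 - 2^-1 : R) *: ((2 : R) *: g).
    by rewrite !scalerA; congr (_ *: _ + _); [lra|rewrite [X in X *: _](_ : _ = 1) ?scale1r//; lra].
  have h : 0 <= (2^-1 : R) <= 1 by lra.
  apply: le_lt_trans (ell_sum_conv _ _ p1 h) _.
  rewrite !ell_sumZ (ell_sum_fin foo) (ell_sum_fin goo).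
  by rewrite -!EFinM -EFinD ltry.
- apply/in_c0P => eps e0; rewrite [X in finite_set X](_ : _ = set0)//.
  by apply/seteqP; split => // r /=; rewrite normr0 ltNge (ltW e0).
- move=> a f g /in_c0P foo /in_c0P goo.
  apply/in_c0P => eps e0.
  have a0 : 0 < `|a| + 1 by rewrite ltr_wpDl.
  have e1 : 0 < eps / 2 / (`|a| + 1) by rewrite !divr_gt0.
  have e2 : 0 < eps / 2 by rewrite divr_gt0.
  have fin : finite_set ([set r | `|f r| > eps / 2 / (`|a| + 1)] `|`
                         [set r | `|g r| > eps / 2]).
    by rewrite finite_setU; split; [exact: foo|exact: goo].
  apply: sub_finite_set fin => r /= h.
  have [fr|?] := leP `|f r| (eps / 2 / (`|a| + 1)); last by left.
  have [gr|?] := leP `|g r| (eps / 2); last by right.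
  move: h; rewrite ltNge => /negP[].
  rewrite [leRHS]splitr (le_trans (ler_normD _ _))// lerD//.
  rewrite ler_pdivlMr// mulrC in fr.
  have -> : (a *: f) r = a * f r by [].
  by rewrite normrM (le_trans _ fr)// ler_wpM2r// lerDl.
Qed.

HB.instance Definition _ S := GRing.isSubmodClosed.Build R (R -> R)
  (in_fspace S) (in_fspace_submod_closed S).

Lemma indic_in_fspace S (r : R) : (\1_[set r] : R -> R) \in in_fspace S.
Proof.
case: S => [p p1|]; first by rewrite in_ellE; exact: ell_sum_indic.
apply/in_c0P => eps e0; apply: sub_finite_set (finite_set1 r) => s /=.
rewrite indicE; case: (boolP (s \in [set r])) => [/set_mem//|_].
by rewrite normr0 ltNge (ltW e0).
Qed.

Record vec S : Type := Vec { fval :> R -> R ; _ : fval \in in_fspace S }.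

HB.instance Definition _ S := [isSub for @fval S].
HB.instance Definition _ S := gen_eqMixin (vec S).
HB.instance Definition _ S := gen_choiceMixin (vec S).
HB.instance Definition _ S := [SubChoice_isSubLmodule of vec S by <:].

Lemma vecP S (x : vec S) : fval x \in in_fspace S.
Proof. by case: x. Qed.

Lemma c0_bounded f : f \in in_fspace c0 ->
  has_sup [set `|f r| | r in [set: R]].
Proof.
move=> /in_c0P /(_ 1 ltr01) fin; split; first by exists `|f 0|, 0.
pose F := (fun r => `|f r|) @` [set r | `|f r| > 1].
have finF : finite_set F by exact: finite_image.
exists (1 + \sum_(x \in F) `|x|) => _ [r _ <-].
have sum0 : 0 <= \sum_(x \in F) `|x| by exact: fsumr_ge0.
have [fr|fr] := leP `|f r| 1; first by rewrite (le_trans fr)// lerDl.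
have Ffr : F `|f r| by exists r.
rewrite (fsbigD1 `|f r|)//= normr_id.
rewrite addrCA lerDl addr_ge0//; exact: fsumr_ge0.
Qed.

Lemma ell_norm_ge0 p f : 0 <= fine (ell_sum p f) `^ p^-1.
Proof. exact: powR_ge0. Qed.

Lemma ell_normK p f : 1 <= p -> (ell_sum p f < +oo)%E ->
  ell_sum p f = ((fine (ell_sum p f) `^ p^-1) `^ p)%:E.
Proof.
move=> p1 foo; have p0 : 0 < p by rewrite (lt_le_trans ltr01).
rewrite -powRrM mulVf ?gt_eqF//.
rewrite powRr1; first exact: ell_sum_fin.
by apply: fine_ge0; exact: ell_sum_ge0.
Qed.

Lemma ell_minkowski p f g : 1 <= p ->
  (ell_sum p f < +oo)%E -> (ell_sum p g < +oo)%E ->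
  fine (ell_sum p (f + g)) `^ p^-1 <=
  fine (ell_sum p f) `^ p^-1 + fine (ell_sum p g) `^ p^-1.
Proof.
move=> p1 foo goo; have p0 : 0 < p by rewrite (lt_le_trans ltr01).
have := ell_normK p1 foo; have := ell_normK p1 goo.
have := ell_norm_ge0 p f; have := ell_norm_ge0 p g.
have [a aE] : exists a, fine (ell_sum p f) `^ p^-1 = a by eexists.
have [b bE] : exists b, fine (ell_sum p g) `^ p^-1 = b by eexists.
rewrite aE bE => b0 a0 eb ea.
have [a00|an0] := eqVneq a 0.
  have f0 : f = 0 by apply: (ell_sum_eq0 p1); rewrite ea a00 powR0// gt_eqF.
  have -> : f + g = g by rewrite f0; exact: add0r.
  by rewrite bE lerDr.
have [b00|bn0] := eqVneq b 0.
  have g0 : g = 0 by apply: (ell_sum_eq0 p1); rewrite eb b00 powR0// gt_eqF.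
  have -> : f + g = f by rewrite g0; exact: addr0.
  by rewrite aE lerDl.
have {a0 an0}a0 : 0 < a by rewrite lt_def an0.
have {b0 bn0}b0 : 0 < b by rewrite lt_def bn0.
have ab0 : 0 < a + b by rewrite addr_gt0.
pose t := a / (a + b).
have t01 : 0 <= t <= 1.
  rewrite /t divr_ge0 ?(ltW a0) ?(ltW ab0)//=.
  by rewrite ler_pdivrMr// mul1r lerDl ltW.
have tE : 1 - t = b / (a + b) by rewrite /t; field; rewrite gt_eqF.
have fgE : f + g = (a + b) *: (t *: (a^-1 *: f) + (1 - t) *: (b^-1 *: g)).
  rewrite scalerDr !scalerA tE /t; congr (_ + _).
    by rewrite [X in X *: _](_ : _ = 1) ?scale1r//; field; rewrite !gt_eqF.
  by rewrite [X in X *: _](_ : _ = 1) ?scale1r//; field; rewrite !gt_eqF.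
have le1 : (ell_sum p (f + g)%R <= ((a + b) `^ p)%:E)%E.
  rewrite fgE ell_sumZ (gtr0_norm ab0) -[leRHS]mule1 lee_wpmul2l//.
    by rewrite lee_fin powR_ge0.
  apply: le_trans (ell_sum_conv _ _ p1 t01) _.
  rewrite !ell_sumZ ea eb -!EFinM -EFinD lee_fin.
  by rewrite -!powRM// ?gtr0_norm ?invr_gt0 ?invr_ge0 ?(ltW a0) ?(ltW b0)//
    !mulVf ?gt_eqF// powR1 !mulr1 addrC subrK.
have -> : a + b = ((a + b) `^ p) `^ p^-1.
  by rewrite -powRrM mulfV ?gt_eqF// powRr1// ltW.
apply: ge0_ler_powR; rewrite ?nnegrE ?powR_ge0 ?invr_ge0 ?(ltW p0)//.
  by rewrite fine_ge0// ell_sum_ge0.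
by rewrite -lee_fin -ell_sum_fin// (le_lt_trans le1)// ltry.
Qed.

Lemma vec_normD S (x y : vec S) :
  fspace_norm S (x + y) <= fspace_norm S x + fspace_norm S y.
Proof.
have := vecP y; have := vecP x.
rewrite (_ : fval (x + y) = fval x + fval y)//.
move: (fval x) (fval y) => {x y} f g.
case: S => [p p1|]; first exact: ell_minkowski.
move=> fS gS; have sf := c0_bounded fS; have sg := c0_bounded gS.
apply: ge_sup; first by exists `|(f + g) 0|, 0.
move=> _ [r _ <-]; rewrite (le_trans (ler_normD _ _))// lerD//.
  by apply: ub_le_sup; [case: sf|exists r].
by apply: ub_le_sup; [case: sg|exists r].
Qed.

Lemma vec_normZ S (c : R) (x : vec S) :
  fspace_norm S (c *: x) = `|c| * fspace_norm S x.
Proof.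
have := vecP x; rewrite (_ : fval (c *: x) = c *: fval x)//.
move: (fval x) => {x} f.
case: S => [p p1|] fS /=.
  have p0 : 0 < p by rewrite (lt_le_trans ltr01).
  rewrite in_ellE in fS.
  rewrite ell_sumZ (ell_sum_fin fS) -EFinM /= powRM ?powR_ge0//.
    by rewrite -powRrM mulfV ?gt_eqF// powRr1.
  by rewrite fine_ge0// ell_sum_ge0.
have sf := c0_bounded fS.
have le1 (a : R) (h : R -> R) : h \in in_fspace c0 ->
    sup [set `|(a *: h) r| | r in [set: R]] <=
    `|a| * sup [set `|h r| | r in [set: R]].
  move=> /c0_bounded sh; apply: ge_sup; first by exists `|(a *: h) 0|, 0.
  move=> _ [r _ <-]; rewrite [leLHS]normrM ler_wpM2l//.
  by apply: ub_le_sup; [case: sh|exists r].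
apply/eqP; rewrite eq_le le1//=.
have [->|cn0] := eqVneq c 0.
  rewrite normr0 mul0r; apply: (@le_trans _ _ `|(0 *: f) 0|) => //.
  apply: ub_le_sup; last by exists 0.
  by case: (c0_bounded (rpredZ 0 fS)).
have := le1 c^-1 (c *: f) (rpredZ c fS).
rewrite scalerA mulVf// scale1r => /(ler_wpM2l (normr_ge0 c)).
by rewrite mulrA -normrM divff// normr1 mul1r.
Qed.

Lemma vec_norm0_eq0 S (x : vec S) : fspace_norm S x = 0 -> x = 0.
Proof.
move=> x0; apply: val_inj; change (fval x = 0).
have := vecP x; move: x0; move: (fval x) => {x} f.
case: S => [p p1|] f0 fS.
  have p0 : 0 < p by rewrite (lt_le_trans ltr01).
  rewrite /= in f0.
  by apply: (ell_sum_eq0 p1); rewrite (ell_normK p1 fS) f0 powR0// gt_eqF.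
apply/funext => r; apply/normr0_eq0/eqP; rewrite eq_le normr_ge0 andbT.
by rewrite -f0; apply: ub_le_sup; [case: (c0_bounded fS)|exists r].
Qed.

HB.instance Definition _ S := Lmodule_isNormed.Build R (vec S)
  (@vec_normD S) (@vec_normZ S) (@vec_norm0_eq0 S).

Definition unit_vec S (r : R) : vec S := Vec (indic_in_fspace S r).

End fspace.

(* Main.v *)
Require Import Defs.
From mathcomp Require Import all_boot all_order all_algebra.
From mathcomp Require Import all_classical all_reals all_analysis.
From mathcomp Require Import lra ring.

Import Order.TTheory GRing.Theory Num.Theory.
Import numFieldNormedType.Exports.

Local Open Scope classical_set_scope.
Local Open Scope ring_scope.

(** Write [p r x t] for [T t (unit_vec E r) x], a nonnegative function that is
    continuous in [t > 0].

    Part (a): each vector has countable support, and by continuity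
    [T t f r != 0] for some [t > 0] implies the same for some rational [t].

    Part (b) is a version of Levy's dichotomy for Markov chains. The semigroup
    law reads [p r y (t + u) = \sum_x p r x t * p x y u]. This rests on order
    continuity of positive operators: [S f y] is the supremum of the finite sums
    of [f x * S (unit_vec E x) y] when [f >= 0] ([order_continuity]). So,
    fixing [r], [s] and [t0] with [p r s t0 > 0], the numbers
    [p r x v * p x s (t0 - v)] distribute the total mass [p r s t0] over the
    positions [x] at time [v] of imagined paths from [r] to [s]. Each of them is
    continuous in [v] and their sum is constant, so that during a short time
    almost all of the mass is carried by one fixed finite set.

    Before [t0] ([p_gt0_before]). For [p r x v > 0] let [last_zero r x v] be the
    last time before [v] at which [p r x] vanishes, or 0. It is locally constant
    in [v], and along a transition from [x] to [y] in time [u] it grows by at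
    most [u]. But on a finite set it takes finitely many values, so that growth
    by at most [u] means no growth at all when [u] is small. Therefore its mean
    over the paths grows during [u] only by [o(u)]: the mean decreases
    ([upper_dini_le]). Being at most [v] times the mass, it is zero. Hence all
    positions [x] taken by the paths at time [v] have [p r x > 0] on the whole of
    [(0, v]], and following such an [x] to [s] gives [p r s > 0] on [(0, t0]].

    After [t0] ([p_gt0_after]). If [p r s] vanished later, the positions [x]
    would have finite lifetimes [sup {t | p r x t > 0}], growing by at least [u]
    along each transition in time [u]. Then the mass of the paths whose position
    has lifetime at most [l] would jump down at every time [v] by the mass at
    lifetime exactly [l], contradicting continuity on finite sets. *)

Set Implicit Arguments.
Unset Strict Implicit.

(** * Domination and countable supports in the sequence spaces *)

Section lattice.
Context {R : realType}.
Implicit Types (E : fspace R) (f g w : R -> R).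

(** This is what makes multiplication by a bounded function act on [vec E]. *)
Lemma fspace_ideal E f g : f \in in_fspace E ->
  (exists C, forall r, `|g r| <= C * `|f r|) -> g \in in_fspace E.
Proof.
move=> fE [C0 gf0].
have [C C_gt0 gf] : exists2 C, 0 < C & forall r, `|g r| <= C * `|f r|.
  exists (`|C0| + 1) => [|r]; first by rewrite ltr_wpDl.
  rewrite (le_trans (gf0 r))// ler_wpM2r// (le_trans (ler_norm _))//.
  by rewrite lerDl.
case: E fE => [p p1|].
  have p0 : 0 <= p by exact: le_trans p1.
  rewrite !in_ellE => fE.
  have := ell_sumZ p C f; rewrite (ell_sum_fin fE) -EFinM => CfE.
  apply: (@le_lt_trans _ _ (ell_sum p (C *: f))); last by rewrite CfE ltry.
  apply: le_esum => r _; rewrite lee_fin ge0_ler_powR ?nnegrE//.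
  rewrite (_ : (C *: f) r = C * f r)// normrM (gtr0_norm C_gt0).
  exact: gf.
move=> /in_c0P fE; apply/in_c0P => e e0; have := fE _ (divr_gt0 e0 C_gt0).
apply: sub_finite_set => r /= er.
by rewrite ltr_pdivrMr// mulrC (lt_le_trans er).
Qed.

Lemma coord_le_norm E (f : vec E) r : `|f r| <= `|f|.
Proof.
rewrite (_ : `|f| = fspace_norm E f)//.
have := vecP f; case: E f => [p p1|] f; last first.
  by move=> fE; apply: ub_le_sup; [case: (c0_bounded fE)|exists r].
have p0 : 0 < p by rewrite (lt_le_trans ltr01).
rewrite in_ellE => fE; rewrite /fspace_norm.
have : ((`|f r| `^ p)%:E <= ell_sum p f)%E.
  apply: esum_ge; exists [set r]; last by rewrite fsbig_set1.
  by split => //; exact: finite_set1.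
rewrite (ell_sum_fin fE) lee_fin => h.
rewrite -[leLHS]powRr1// -(@mulfV _ p) ?gt_eqF// powRrM.
by rewrite ge0_ler_powR ?nnegrE ?powR_ge0 ?invr_ge0 ?fine_ge0 ?lee_fin
  ?fine_ge0 ?ell_sum_ge0 ?(ltW p0).
Qed.

(** A summable family stays summable when multiplied by a suitable unbounded
    weight. Choose finite sets [K n] outside of which [F] has sum at most
    [2^-(n+1)]; the weight counts the [n] with [r \notin K n], so that
    exchanging the two sums gives a total of at most [1], while the weight is
    at least [n] outside [K 0], ..., [K (n-1)]. *)
Lemma ell1_dominating (F : R -> R) : (forall r, 0 <= F r) ->
  (\esum_(r in [set: R]) (F r)%:E < +oo)%E ->
  exists G : R -> R, [/\ forall r, 0 <= G r,
    (\esum_(r in [set: R]) (G r)%:E < +oo)%E &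
    forall M, exists K : seq R, forall r, r \notin K -> M * F r <= G r].
Proof.
move=> F0 Foo.
have FE0 r : (0 <= (F r)%:E)%E by rewrite lee_fin.
have tail n : exists K : seq R,
    (\esum_(r in ~` [set` K]) (F r)%:E <= (1 / (2 ^ n.+1)%:R)%:E)%E.
  have totfin : \esum_(r in [set: R]) (F r)%:E \is a fin_num.
    by rewrite ge0_fin_numE// esum_ge0.
  have e0 : 0 < (1 / (2 ^ n.+1)%:R : R) by rewrite divr_gt0 // ltr0n expn_gt0.
  have [_ [X [finX _] <-] hX] := ub_ereal_sup_adherent e0 totfin.
  have /finite_seqP[K XE] := finX; exists K; rewrite -XE.
  have := esumID X [set: R] (EFin \o F) (fun r _ => FE0 r); rewrite !setTI.
  rewrite (@esum_fset _ _ X)//; last by move=> r _; exact: FE0.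
  move=> totE.
  move: hX; rewrite [ereal_sup _]totE.
  rewrite fsbig_finite//= sumEFin.
  case: (esum (~` X) _) => [x| |] //=.
    by rewrite -?EFinB -?EFinD lte_fin lee_fin; lra.
  by move=> _; rewrite leNye.
pose K n := projT1 (cid (tail n)).
have KE n : (\esum_(r in ~` [set` K n]) (F r)%:E <= (1 / (2 ^ n.+1)%:R)%:E)%E.
  by rewrite /K; case: cid.
pose h r n : \bar R := if r \in K n then 0%E else (F r)%:E.
have h0 r n : (0 <= h r n)%E by rewrite /h; case: ifP.
pose G r : \bar R := (\sum_(n <oo) h r n)%E.
have G0 r : (0 <= G r)%E by exact: nneseries_ge0.
have GE : (\esum_(r in [set: R]) G r <= 1)%E.
  apply: ge_ereal_sup => _ [X [finX _] <-].
  rewrite fsbig_finite//= /G -nneseries_sum//.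
  apply: (@le_trans _ _ (\sum_(n <oo) (1 / (2 ^ n.+1)%:R : R)%:E)%E); last first.
    exact: epsilon_trick0.
  apply: lee_nneseries => [n _ _|n _]; first exact: sume_ge0.
  apply: le_trans (KE n); rewrite esum_mkcond.
  apply: esum_ge; exists X => //.
  rewrite fsbig_finite//= le_eqVlt; apply/orP; left; apply/eqP.
  by apply: eq_bigr => r _; rewrite /h in_setC mem_setE; case: ifP.
have Gfin r : G r \is a fin_num.
  rewrite ge0_fin_numE//; apply: le_lt_trans (ltry 1); apply: le_trans GE.
  apply: esum_ge; exists [set r]; last by rewrite fsbig_set1.
  by split => //; exact: finite_set1.
exists (fun r => fine (G r)); split.
- by move=> r; rewrite fine_ge0.
- under eq_esum do rewrite fineK//.
  exact: le_lt_trans GE (ltry 1).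
- move=> M; pose n := (Num.truncn M).+1.
  exists (flatten [seq K i | i <- iota 0 n]) => r rK.
  rewrite -lee_fin fineK//.
  apply: le_trans (nneseries_lim_ge n (fun i _ _ => h0 r i)).
  rewrite big_nat (eq_bigr (fun=> (F r)%:E)) => [|i /andP[_ i_n]]; last first.
    rewrite /h; case: ifP => // rKi; case/negP: rK.
    by apply/flattenP; exists (K i) => //; apply: map_f; rewrite mem_iota.
  rewrite -big_nat sumEFin lee_fin big_const_nat subn0 iter_addr_0 -mulr_natl.
  by rewrite ler_wpM2r// ltW// truncnS_gt.
Qed.

(** Every vector is negligible against some other vector, away from finite
    sets. This single property of the spaces replaces boundedness of positive
    operators, and hence completeness: it yields both the countability of
    supports and order continuity. In [c0] the square root of [`|f|] does it;
    in [ell p] take the [p]-th root of the dominating family of [`|f|^p]. *)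
Lemma dominating E (f : vec E) : exists g : vec E,
  (forall r, 0 <= g r) /\
  forall M, exists K : seq R, forall r, r \notin K -> M * `|f r| <= g r.
Proof.
have := vecP f; case: E f => [p p1|] f.
  have p0 : 0 < p by rewrite (lt_le_trans ltr01).
  rewrite in_ellE => fE.
  have [G [G0 Goo GF]] := @ell1_dominating (fun r => `|f r| `^ p)
    (fun r => powR_ge0 `|f r| p) fE.
  have gE : (fun r => G r `^ p^-1) \in in_fspace (ell p1).
    rewrite in_ellE; apply: le_lt_trans Goo; apply: le_esum => r _.
    by rewrite lee_fin ger0_norm ?powR_ge0// -powRrM mulVf ?gt_eqF// powRr1.
  exists (Vec gE); split=> [r|M]; first exact: powR_ge0.
  have [K hK] := GF (`|M| `^ p); exists K => r /hK.
  rewrite -powRM// => h /=.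
  apply: (@le_trans _ _ (`|M| * `|f r|)); first by rewrite ler_wpM2r// ler_norm.
  rewrite -[leLHS]powRr1 ?mulr_ge0// -(@mulfV _ p) ?gt_eqF// powRrM.
  by rewrite ge0_ler_powR ?nnegrE ?powR_ge0 ?invr_ge0 ?(ltW p0).
move=> /in_c0P fE.
have gE : (fun r => Num.sqrt `|f r|) \in in_fspace c0.
  apply/in_c0P => e e0; apply: sub_finite_set (fE (e ^+ 2) _); last first.
    by rewrite exprn_gt0.
  move=> r /=; rewrite ger0_norm ?sqrtr_ge0// => er.
  by rewrite -[ltRHS]sqr_sqrtr// ltrXn2r// ltW.
exists (Vec gE); split=> [r|M]; first exact: sqrtr_ge0.
have M0 : 0 < `|M| + 1 by rewrite ltr_wpDl.
have /finite_seqP[K KE] : finite_set [set r | `|f r| > ((`|M| + 1) ^-1) ^+ 2].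
  by apply: fE; rewrite exprn_gt0// invr_gt0.
exists K => r rK /=.
have fr : `|f r| <= ((`|M| + 1) ^-1) ^+ 2.
  rewrite leNgt; apply/negP => fr; case/negP: rK.
  by have : [set` K] r by rewrite -KE.
have fr' : Num.sqrt `|f r| <= (`|M| + 1)^-1.
  by rewrite -[leRHS]gtr0_norm ?invr_gt0// -[leRHS]sqrtr_sqr ler_wsqrtr.
rewrite -[X in M * X]sqr_sqrtr// expr2 mulrA -[leRHS]mul1r ler_wpM2r ?sqrtr_ge0//.
apply: (@le_trans _ _ ((`|M| + 1) * (`|M| + 1)^-1)); last by rewrite mulfV ?gt_eqF.
rewrite (@le_trans _ _ ((`|M| + 1) * Num.sqrt `|f r|))// ?ler_wpM2l// ?(ltW M0)//.
by rewrite ler_wpM2r ?sqrtr_ge0// (le_trans (ler_norm M))// lerDl.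
Qed.

(** Outside the countable union of the finite exceptional sets,
    [n * `|f r| <= g r] for all [n]. *)
Lemma countable_support E (f : vec E) : countable [set r | f r != 0].
Proof.
have [g [g0 fg]] := dominating f.
pose K n := projT1 (cid (fg n%:R)).
have KE n r : r \notin K n -> n%:R * `|f r| <= g r.
  exact: projT2 (cid (fg n%:R)) r.
apply: (@sub_countable _ _ _ (\bigcup_n [set` K n])); last first.
  by apply: bigcup_countable => // n _; exact: finite_set_countable.
apply: subset_card_le => r /= fr0; apply: contrapT => rK.
have fr : 0 < `|f r| by rewrite normr_gt0.
have /(_ (Num.truncn (g r / `|f r|)).+1) : forall n : nat, n%:R * `|f r| <= g r.
  by move=> n; apply: KE; apply/negP => rKn; apply: rK; exists n.
by rewrite -ler_pdivlMr// leNgt truncnS_gt.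
Qed.
End lattice.

(** * Bounded multipliers *)

Section multiplication.
Context {R : realType} {E : fspace R}.
Implicit Types (f g : vec E) (w : R -> R) (K : seq R).

Lemma vecDE f g r : (f + g) r = f r + g r. Proof. by []. Qed.
Lemma vecNE f r : (- f) r = - f r. Proof. by []. Qed.
Lemma vecZE (a : R) f r : (a *: f) r = a * f r. Proof. by []. Qed.
Lemma vec_sumE (I : Type) (K : seq I) (F : I -> vec E) r :
  (\sum_(i <- K) F i) r = \sum_(i <- K) F i r.
Proof. exact: (big_morph (fun f : vec E => f r)). Qed.

Lemma vec_ext f g : (forall r, f r = g r) -> f = g.
Proof. by move=> fg; apply: val_inj; apply/funext. Qed.

Lemma unit_vecE r x : unit_vec E r x = (x == r)%:R.
Proof. rewrite /unit_vec/= indicE; congr (nat_of_bool _)%:R.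
by apply/idP/eqP => [/set_mem//|->]; apply/mem_set. Qed.

(** The value 0 outside of the space is never met: [w] is always bounded. *)
Definition mulv w f : vec E := insubd (0 : vec E) (fun r => w r * f r).

Lemma mulvE (C : R) w f r : (forall x, `|w x| <= C) -> mulv w f r = w r * f r.
Proof.
move=> wC; have wfE : (fun r => w r * f r) \in in_fspace E.
  by apply: (fspace_ideal (vecP f)); exists C => x; rewrite normrM ler_wpM2r.
exact: (congr1 (fun h => h r) (insubdK (0 : vec E) wfE)).
Qed.

Lemma mulv_boolE (P : pred R) f r : mulv (fun x => (P x)%:R) f r = (P r)%:R * f r.
Proof. by apply: (@mulvE 1) => x; case: (P x); rewrite ?normr1 ?normr0. Qed.

Definition off K f := mulv (fun x => (x \notin K)%:R) f.

Lemma offE K f r : off K f r = (r \notin K)%:R * f r.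
Proof. exact: mulv_boolE. Qed.

Lemma off_nil f : off [::] f = f.
Proof. by apply: vec_ext => r; rewrite offE mul1r. Qed.

Lemma off_decomp K f : uniq K ->
  f = \sum_(x <- K) f x *: unit_vec E x + off K f.
Proof.
move=> uK; apply: vec_ext => r; rewrite vecDE offE vec_sumE.
under eq_bigr do rewrite vecZE unit_vecE.
case: (boolP (r \in K)) => [rK|rK].
  rewrite mul0r addr0 (bigD1_seq r)//= eqxx mulr1 big1 ?addr0// => x.
  by rewrite eq_sym => /negbTE->; rewrite mulr0.
rewrite mul1r big_seq big1 ?add0r// => x xK.
by case: eqP => [rx|]; rewrite ?mulr0//; rewrite rx xK in rK.
Qed.

End multiplication.

(** * Order continuity of positive operators *)

Section positive_operators.
Context {R : realType} {E : fspace R}.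
Implicit Types (f g : vec E) (K : seq R) (S : {linear vec E -> vec E}).

Definition positive S := forall f, (forall r, 0 <= f r) -> forall r, 0 <= S f r.

Lemma positive_le S f g : positive S -> (forall r, f r <= g r) ->
  forall r, S f r <= S g r.
Proof.
move=> S0 fg r; rewrite -subr_ge0 -vecNE -vecDE -raddfB; apply: S0 => x.
by rewrite vecDE vecNE subr_ge0.
Qed.

Lemma opZE S (a : R) f y : S (a *: f) y = a * S f y.
Proof. by rewrite -vecZE; congr (fval _ _); exact: linearZ_LR. Qed.

Lemma opBE S f g y : S (f - g) y = S f y - S g y.
Proof. by rewrite -vecNE -vecDE; congr (fval _ _); exact: raddfB. Qed.

Lemma op_decomp S K f y : uniq K ->
  S f y = \sum_(x <- K) f x * S (unit_vec E x) y + S (off K f) y.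
Proof.
move=> uK; rewrite {1}(off_decomp f uK) raddfD vecDE raddf_sum vec_sumE.
by congr (_ + _); apply: eq_bigr => x _; rewrite opZE.
Qed.

(** If [g] dominates [f] then [f] is at most [e / (S g y + 1)] times [g] off a
    finite set, and [S] respects this. Points where [f] vanishes can be dropped
    from that set, so that it lies in the support of [f]. *)
Lemma order_continuity S f y (e : R) : positive S -> (forall r, 0 <= f r) ->
  0 < e -> exists K, [/\ uniq K, forall x, x \in K -> 0 < f x &
    S (off K f) y <= e].
Proof.
move=> S0 f0 e0; have [g [g0 fg]] := dominating f.
have M0 : 0 < (S g y + 1) / e by rewrite divr_gt0// ltr_wpDl// S0.
have [K hK] := fg ((S g y + 1) / e).
exists (undup [seq x <- K | 0 < f x]); split; first exact: undup_uniq.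
  by move=> x; rewrite mem_undup mem_filter => /andP[].
have : S ((S g y + 1) / e *: off (undup [seq x <- K | 0 < f x]) f) y <= S g y.
  apply: positive_le => // x; rewrite vecZE offE mem_undup mem_filter negb_and.
  have [fx|fx] /= := ltP 0 (f x); last first.
    have -> : f x = 0 by apply/eqP; rewrite eq_le fx f0.
    by rewrite !mulr0.
  case: (boolP (x \in K)) => /= [_|/hK]; first by rewrite mul0r mulr0.
  by rewrite mul1r gtr0_norm.
rewrite opZE => h.
have {}h : (S g y + 1) / e * S (off (undup [seq x <- K | 0 < f x]) f) y <=
   (S g y + 1) / e * e.
  by rewrite mulfVK ?gt_eqF// (le_trans h)// lerDl.
by rewrite ler_pM2l in h.
Qed.

(** The kernel [S (unit_vec E x) y] determines [S]: a positive operator cannot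
    see values of [f] at points [x] where the kernel vanishes, as by order
    continuity only finite sums matter. Pointwise inequalities for all
    operators below are checked along [x]-to-[y] transitions by this lemma. *)
Lemma positive_le0 S f y : positive S ->
  (forall x, 0 < S (unit_vec E x) y -> f x <= 0) -> S f y <= 0.
Proof.
move=> S0 f0.
pose fp := mulv (fun x => (0 < f x)%R%:R) f.
have fpE x : fp x = (0 < f x)%R%:R * f x by exact: mulv_boolE.
have fp0 x : 0 <= fp x.
  by rewrite fpE; case: ltP => [/ltW|_]; rewrite ?mul1r ?mul0r.
apply: (@le_trans _ _ (S fp y)).
  apply: positive_le => // x; rewrite fpE.
  by case: ltP => [fx|fx]; rewrite ?mul1r ?mul0r.
apply/ler_addgt0Pr => e e0; rewrite add0r.
have [K [uK _ hK]] := order_continuity y S0 fp0 e0.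
rewrite (op_decomp _ _ _ uK) big1 ?add0r// => x _.
rewrite fpE; case: ltP => [fx|_]; last by rewrite !mul0r.
have : 0 <= S (unit_vec E x) y.
  by apply: S0 => z; rewrite unit_vecE; case: eqP.
rewrite le_eqVlt => /predU1P[<-|/f0]; first by rewrite mulr0.
by rewrite leNgt fx.
Qed.

Lemma positive_gt0_ex S f y : positive S -> 0 < S f y ->
  exists x, 0 < S (unit_vec E x) y /\ 0 < f x.
Proof.
move=> S0; rewrite ltNge => Sf; apply: contrapT => h; case/negP: Sf.
apply: positive_le0 => // x Sx; rewrite leNgt; apply/negP => fx.
by apply: h; exists x.
Qed.

Lemma finite_sum_le S K f y : positive S -> (forall r, 0 <= f r) -> uniq K ->
  \sum_(x <- K) f x * S (unit_vec E x) y <= S f y.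
Proof.
move=> S0 f0 uK; rewrite (op_decomp _ _ _ uK) lerDl; apply: S0 => r.
by rewrite offE mulr_ge0.
Qed.

End positive_operators.

(** * Two facts about one-sided limits *)

Section dini.
Context {R : realType}.

(** A function whose upper right Dini derivative is nonpositive decreases. In
    place of continuity, a one-sided Lipschitz bound prevents upward jumps, so
    that the set where [phi v <= phi a + e * (v - a)] contains its supremum. *)
Lemma upper_dini_le (phi : R -> R) (M a b : R) : a < b ->
  (forall v u, a <= v -> 0 < u -> v + u <= b -> phi (v + u) <= phi v + u * M) ->
  (forall v, a <= v < b -> forall e, 0 < e ->
    \forall u \near (0 : R)^'+, phi (v + u) <= phi v + u * e) ->
  phi b <= phi a.
Proof.
move=> ab lip dini.
suff h e : 0 < e -> phi b <= phi a + e * (b - a).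
  apply/ler_addgt0Pr => e e0.
  have ba : 0 < b - a by rewrite subr_gt0.
  by have := h _ (divr_gt0 e0 ba); rewrite mulfVK// gt_eqF.
move=> e0; pose A := [set v | a <= v <= b /\ phi v <= phi a + e * (v - a)].
have Aa : A a by split; rewrite ?lexx ?(ltW ab)// subrr mulr0 addr0.
have supA : has_sup A by split; [exists a|exists b => v [/andP[]]].
pose c := sup A.
have ac : a <= c by apply: ub_le_sup => //; case: supA.
have cb : c <= b by apply: ge_sup => [|v [/andP[]]//]; exists a.
have Ac : phi c <= phi a + e * (c - a).
  apply/ler_addgt0Pr => d d0.
  have M0 : 0 < `|M| + 1 by rewrite ltr_wpDl.
  have [v [/andP[av vb] phiv] cv] := sup_adherent (divr_gt0 d0 M0) supA.
  rewrite -/c in cv.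
  have vc : v <= c by apply: ub_le_sup; [case: supA|split; rewrite ?av].
  move: vc; rewrite le_eqVlt => /predU1P[vc|vc].
    by rewrite -vc (le_trans phiv)// lerDl ltW.
  have u0 : 0 < c - v by rewrite subr_gt0.
  have := lip v (c - v) av u0; rewrite addrC subrK => /(_ cb) hc.
  apply: (le_trans hc).
  have h1 : (c - v) * M <= (c - v) * (`|M| + 1).
    by rewrite ler_pM2l// (le_trans (ler_norm M))// lerDl.
  have h2 : (c - v) * (`|M| + 1) <= d.
    by rewrite -ler_pdivlMr//; lra.
  have h3 : e * (v - a) <= e * (c - a) by rewrite ler_pM2l//; lra.
  lra.
move: cb; rewrite le_eqVlt => /predU1P[<-//|cb].
exfalso.
have : \forall u \near (0 : R)^'+, False.
  near=> u.
  have u0 : 0 < u by near: u; exact: nbhs_right_gt.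
  have hu : phi (c + u) <= phi c + u * e.
    by near: u; apply: dini => //; rewrite ac.
  have : c + u <= c.
    apply: ub_le_sup; first by case: supA.
    have ucb : u < b - c by near: u; apply: nbhs_right_lt; rewrite subr_gt0.
    split; last by lra.
    by apply/andP; split; lra.
  by lra.
by move=> /filter_ex[].
Unshelve. all: by end_near. Qed.

Lemma near_all_seq {T : Type} {I : eqType} (F : set_system T) {FF : Filter F}
    (K : seq I) (P : I -> T -> Prop) :
  (forall i, i \in K -> \forall t \near F, P i t) ->
  \forall t \near F, forall i, i \in K -> P i t.
Proof.
elim: K => [|i K IH] h; first by near=> t.
have h1 : \forall t \near F, P i t by apply: h; rewrite mem_head.
have h2 : \forall t \near F, forall j, j \in K -> P j t.
  by apply: IH => j jK; apply: h; rewrite inE jK orbT.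
near=> t => j; rewrite inE => /predU1P[->|]; [near: t|move: j; near: t]; done.
Unshelve. all: by end_near. Qed.

End dini.

(** * Semigroups with continuous orbits *)

Section semigroup.
Context {R : realType} {E : fspace R} (T : R -> {linear vec E -> vec E}).
Implicit Types (f g : vec E) (K : seq R) (r s x y t u v : R).
Context (T_semigroup : forall t s : R, 0 < t -> 0 < s ->
      forall f : vec E, T (t + s) f = T t (T s f))
    (T_positive : forall t : R, 0 < t -> positive (T t))
    (T_continuous : forall f : vec E,
      {within `]0, +oo[, continuous (fun t : R => T t f)}).

Let p r x t := T t (unit_vec E r) x.

Lemma orbit_cvg f y t : 0 < t -> (fun u => T u f y) @ t --> T t f y.
Proof.
move=> t0; have := @T_continuous f.
rewrite continuous_open_subspace; last exact: interval_open.
move=> /(_ t); rewrite inE/= in_itv/= t0 => /(_ isT) Tc.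
apply/cvgrPdist_lt => e e0; move/cvgrPdist_lt : Tc => /(_ e e0).
apply: filterS => u; apply: le_lt_trans.
by rewrite -vecNE -vecDE coord_le_norm.
Qed.

Lemma orbit_cvg_right f y t : 0 < t ->
  (fun u => T (t + u) f y) @ (0 : R)^'+ --> T t f y.
Proof.
move=> t0; have shift : (fun u => t + u) @ (0 : R)^'+ --> t.
  rewrite -[X in _ --> X]addr0; apply: cvgD; first exact: cvg_cst.
  exact: cvg_at_right_filter.
exact: (cvg_comp _ _ shift (@orbit_cvg f y t t0)).
Qed.

Lemma orbit_cvg_left f y t : 0 < t ->
  (fun u => T (t - u) f y) @ (0 : R)^'+ --> T t f y.
Proof.
move=> t0; have shift : (fun u => t - u) @ (0 : R)^'+ --> t.
  rewrite -[X in _ --> X]subr0; apply: cvgB; first exact: cvg_cst.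
  exact: cvg_at_right_filter.
exact: (cvg_comp _ _ shift (@orbit_cvg f y t t0)).
Qed.

Lemma orbit_ge0 r t : 0 < t -> forall x, 0 <= T t (unit_vec E r) x.
Proof.
by move=> t0; apply: T_positive => // z; rewrite unit_vecE; case: eqP.
Qed.

Lemma p_ge0 r x t : 0 < t -> 0 <= p r x t.
Proof. by move=> t0; exact: orbit_ge0. Qed.

Lemma p_gt0_right r x t : 0 < t -> 0 < p r x t ->
  \forall u \near (0 : R)^'+, 0 < p r x (t + u).
Proof.
move=> t0 p0.
exact: (cvgr_gt _ (@orbit_cvg_right (unit_vec E r) x t t0) _ p0).
Qed.

Lemma p_comp r x y t u : 0 < t -> 0 < u ->
  0 < p r x t -> 0 < p x y u -> 0 < p r y (t + u).
Proof.
move=> t0 u0 pt pu; rewrite /p addrC T_semigroup//.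
have := @finite_sum_le _ _ (T u) [:: x] (T t (unit_vec E r)) y
  (T_positive u0) (orbit_ge0 r t0) isT.
by rewrite big_seq1; apply: lt_le_trans; rewrite mulr_gt0.
Qed.

(** Converse of [p_comp]: a transition in time [t + u] passes through some
    point [x] at time [t]. *)
Lemma p_split r y t u : 0 < t -> 0 < u -> 0 < p r y (t + u) ->
  exists x, 0 < p r x t /\ 0 < p x y u.
Proof.
move=> t0 u0; rewrite /p addrC T_semigroup//.
by move=> /(positive_gt0_ex (T_positive u0))[x [? ?]]; exists x.
Qed.

(** The left end of the component of [v] in [{t > 0 | p r x t > 0}], when [v]
    lies in that set; it is 0 when [p r x] is positive on all of [(0, v]]. *)
Definition last_zero r x v :=
  sup [set t | 0 <= t <= v /\ (0 < t -> p r x t = 0)].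

Lemma last_zero_has_sup r x v : 0 <= v ->
  has_sup [set t | 0 <= t <= v /\ (0 < t -> p r x t = 0)].
Proof.
move=> v0; split; last by exists v => t [/andP[]].
by exists 0; split; rewrite ?lexx// ltxx.
Qed.

Lemma last_zero_ge0 r x v : 0 <= v -> 0 <= last_zero r x v.
Proof.
move=> v0; apply: ub_le_sup; first by case: (last_zero_has_sup r x v0).
by split; rewrite ?lexx// ltxx.
Qed.

Lemma last_zero_le r x v : 0 <= v -> last_zero r x v <= v.
Proof.
move=> v0; apply: ge_sup; first by case: (last_zero_has_sup r x v0).
by move=> t [/andP[]].
Qed.

(** [p r y] is positive wherever [p r x], shifted by [u], is. So a zero [t] of
    [p r y] beyond [u] gives the zero [t - u] of [p r x]. *)
Lemma last_zero_step r x y v u : 0 < v -> 0 < u -> 0 < p x y u ->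
  last_zero r y (v + u) <= last_zero r x v + u.
Proof.
move=> v0 u0 pu; apply: ge_sup.
  by case: (@last_zero_has_sup r y (v + u)) => //; rewrite addr_ge0 ?ltW.
move=> t [/andP[t0 tvu] pt].
have [tu|ut] := leP t u.
  by rewrite (le_trans tu)// lerDr last_zero_ge0 ?ltW.
rewrite -lerBlDr; apply: ub_le_sup.
  by case: (last_zero_has_sup r x (ltW v0)).
split; first by rewrite lerBlDr tvu subr_ge0 ltW.
move=> tu0; apply/eqP; rewrite eq_le p_ge0// andbT leNgt; apply/negP => ptu.
have := p_comp tu0 u0 ptu pu.
by rewrite subrK pt ?ltxx// (lt_trans u0).
Qed.

(** [p r x] stays positive on some [[v, v + d)], so no zero is added. *)
Lemma last_zero_right r x v : 0 < v -> 0 < p r x v ->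
  \forall u \near (0 : R)^'+, last_zero r x (v + u) = last_zero r x v.
Proof.
move=> v0 pv.
have [d /= d0 pd] := p_gt0_right v0 pv.
near=> u.
have u0 : 0 < u by near: u; exact: nbhs_right_gt.
have ud : u < d by near: u; exact: nbhs_right_lt.
congr (sup _); apply/seteqP; split => t /= [/andP[t0 tv] pt]; split => //.
  rewrite t0 /= leNgt; apply/negP => vt.
  have tv0 : 0 < t - v by rewrite subr_gt0.
  have : 0 < p r x (v + (t - v)).
    by apply: pd => //=; rewrite sub0r normrN (gtr0_norm tv0); lra.
  rewrite [v + _]addrC subrK.
  by rewrite pt ?ltxx// (lt_trans v0).
by rewrite t0 (le_trans tv)// lerDl ltW.
Unshelve. all: by end_near. Qed.

Lemma last_zero_eq0 r x v t : last_zero r x v = 0 -> 0 < t <= v -> 0 < p r x t.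
Proof.
move=> l0 /andP[t0 tv]; rewrite lt_def p_ge0// andbT.
apply/eqP => pt; have : t <= last_zero r x v.
  apply: ub_le_sup; last by rewrite /= tv ltW.
  by case: (last_zero_has_sup r x (le_trans (ltW t0) tv)).
by rewrite l0 leNgt t0.
Qed.

(** In path language: among the paths from [r] to [s] in time [t0], the mass
    of those that are outside [K] at time [v] is the total mass minus a finite
    sum, which depends continuously on [v] by [bridge_sum_right]. *)
Lemma bridge_off r s t0 v K : 0 < v -> v < t0 -> uniq K ->
  T (t0 - v) (off K (T v (unit_vec E r))) s =
  p r s t0 - \sum_(x <- K) p r x v * p x s (t0 - v).
Proof.
move=> v0 vt uK; have tv : 0 < t0 - v by rewrite subr_gt0.
have -> : p r s t0 = T (t0 - v) (T v (unit_vec E r)) s.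
  by rewrite -T_semigroup// subrK.
by rewrite [in RHS](op_decomp _ _ _ uK) addrAC subrr add0r.
Qed.

Lemma bridge_sum_right r s t0 v K : 0 < v -> v < t0 ->
  (fun u => \sum_(x <- K) p r x (v + u) * p x s (t0 - (v + u))) @ (0 : R)^'+ -->
  \sum_(x <- K) p r x v * p x s (t0 - v).
Proof.
move=> v0 vt.
apply: cvg_big => [|x _]; first exact: add_continuous.
apply: cvgM; first exact: orbit_cvg_right.
under eq_fun do rewrite opprD addrA.
by apply: orbit_cvg_left; rewrite subr_gt0.
Qed.

Section mean_last_zero.
Context (r s t0 : R).

Let mean v := T (t0 - v) (mulv (fun x => last_zero r x v) (T v (unit_vec E r))) s.

Lemma mul_last_zeroE v f x : 0 <= v ->
  mulv (fun x => last_zero r x v) f x = last_zero r x v * f x.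
Proof.
move=> v0; apply: (@mulvE _ _ v) => z.
by rewrite ger0_norm ?last_zero_ge0// last_zero_le.
Qed.

(** If the last zero does not grow on transitions inside [K], then it grows only
    along paths that are outside [K] at time [v] or at time [v + u], and there
    by at most [u]. *)
Lemma mean_step v u K : 0 < v -> 0 < u -> v + u < t0 ->
  (forall x y, x \in K -> y \in K -> 0 < p x y u ->
     last_zero r y (v + u) <= last_zero r x v) ->
  mean (v + u) <= mean v +
    u * (T (t0 - v) (off K (T v (unit_vec E r))) s +
         T (t0 - (v + u)) (off K (T (v + u) (unit_vec E r))) s).
Proof.
move=> v0 u0 vut H.
have w0 : 0 < t0 - (v + u) by rewrite subr_gt0.
have vu0 : 0 < v + u by rewrite addr_gt0.
have tvE g : T (t0 - v) g = T (t0 - (v + u)) (T u g).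
  by rewrite -T_semigroup//; congr (T _ g); ring.
set h := T v (unit_vec E r).
have hE : T (v + u) (unit_vec E r) = T u h by rewrite addrC T_semigroup.
rewrite /mean !tvE hE -/h -vecDE -raddfD -opZE -vecDE -raddfD.
have h0 : forall x, 0 <= h x by exact: orbit_ge0.
apply: (positive_le (T_positive w0)) => y.
rewrite vecDE vecZE vecDE !offE !mul_last_zeroE ?(ltW v0) ?(ltW vu0)//.
(* With [y] fixed, both sides are values of [T u] at [y]; [D] is the vector
   whose image is their difference, and is compared with 0 point by point. *)
pose D := last_zero r y (v + u) *: h - mulv (fun x => last_zero r x v) h
  - u *: off K h - (u * (y \notin K)%:R) *: h.
suff : T u D y <= 0.
  by rewrite /D !opBE !opZE; lra.
apply: (positive_le0 (T_positive u0)) => x pxy.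
rewrite /D !(vecDE, vecNE, vecZE) offE mul_last_zeroE ?(ltW v0)//.
rewrite (_ : _ - _ = (last_zero r y (v + u) - last_zero r x v
  - u * (x \notin K)%:R - u * (y \notin K)%:R) * h x); last by ring.
rewrite mulr_le0_ge0//.
have := last_zero_step r v0 u0 pxy.
case: (boolP (x \in K)) => xK; case: (boolP (y \in K)) => yK /=; last by lra.
- by have := H x y xK yK pxy; lra.
- by lra.
- by lra.
Qed.

(** Take [K] finite carrying all but a small part of the mass. For small [u] the
    last zeros of the points of [K] have not moved and differ, when distinct,
    by more than [u]; by [last_zero_step] they cannot grow along transitions
    inside [K]. Hence [mean_step] applies, with a small mass outside [K]. *)
Lemma mean_dini v : 0 < v -> v < t0 -> forall e, 0 < e ->
  \forall u \near (0 : R)^'+, mean (v + u) <= mean v + u * e.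
Proof.
move=> v0 vt e e0; have tv0 : 0 < t0 - v by rewrite subr_gt0.
have e3 : 0 < e / 3 by rewrite divr_gt0.
have [K [uK K0 Ke]] :=
  order_continuity s (T_positive tv0) (orbit_ge0 r v0) e3.
have keep : \forall u \near (0 : R)^'+, forall x, x \in K ->
    last_zero r x (v + u) = last_zero r x v.
  by apply: near_all_seq => x xK; exact: last_zero_right (K0 x xK).
have gap : \forall u \near (0 : R)^'+, forall x, x \in K -> forall y, y \in K ->
    0 < last_zero r y v - last_zero r x v ->
    u < last_zero r y v - last_zero r x v.
  apply: near_all_seq => x xK; apply: near_all_seq => y yK.
  have [_|gap0] := leP (last_zero r y v - last_zero r x v) 0.
    by near=> u.
  by near=> u => _; near: u; exact: nbhs_right_lt.
have mass : \forall u \near (0 : R)^'+,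
    \sum_(x <- K) p r x v * p x s (t0 - v) - e / 3 <
    \sum_(x <- K) p r x (v + u) * p x s (t0 - (v + u)).
  by apply: (cvgr_gt _ (@bridge_sum_right r s t0 v K v0 vt)); rewrite ltrBlDr ltrDl.
near=> u.
have u0 : 0 < u by near: u; exact: nbhs_right_gt.
have ut : u < t0 - v by near: u; exact: nbhs_right_lt.
have vut : v + u < t0 by lra.
have keep_u : forall x, x \in K -> last_zero r x (v + u) = last_zero r x v.
  by near: u.
have gap_u : forall x, x \in K -> forall y, y \in K ->
    0 < last_zero r y v - last_zero r x v ->
    u < last_zero r y v - last_zero r x v by near: u.
apply: (le_trans (@mean_step v u K v0 u0 vut _)) => [x y xK yK pxy|].
  have := last_zero_step r v0 u0 pxy.
  rewrite keep_u// => yx; rewrite leNgt; apply/negP => xy.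
  by have := gap_u x xK y yK; rewrite subr_gt0 => /(_ xy); lra.
rewrite lerD2l ler_pM2l//.
have vu0 : 0 < v + u by rewrite addr_gt0.
move: Ke; rewrite !bridge_off//.
have : \sum_(x <- K) p r x v * p x s (t0 - v) - e / 3 <
    \sum_(x <- K) p r x (v + u) * p x s (t0 - (v + u)) by near: u.
by lra.
Unshelve. all: by end_near. Qed.

(** The mean decreases, and it tends to 0 at 0 since [last_zero r x a <= a]. *)
Lemma mean_le0 b : 0 < b -> b < t0 -> mean b <= 0.
Proof.
move=> b0 bt; have t00 : 0 < t0 by exact: lt_trans bt.
have mass v : 0 < v -> v < t0 -> T (t0 - v) (T v (unit_vec E r)) s = p r s t0.
  by move=> v0 vt; rewrite -T_semigroup ?subr_gt0// subrK.
have mean_small a : 0 < a -> a < b -> mean b <= a * p r s t0.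
  move=> a0 ab; apply: (@le_trans _ _ (mean a)).
    apply: (@upper_dini_le _ mean (p r s t0 + p r s t0)) => // [v u av u0 vub|].
      have v0 : 0 < v by exact: lt_le_trans av.
      have vut : v + u < t0 by exact: le_lt_trans bt.
      have := @mean_step v u [::] v0 u0 vut.
      by rewrite !off_nil !mass ?addr_gt0//; [apply|lra].
    move=> v /andP[av vb] e e0; apply: mean_dini => //; lra.
  have at0 : a < t0 by exact: lt_trans bt.
  rewrite -(mass a)// -opZE; apply: positive_le => [|x].
    by apply: T_positive; rewrite subr_gt0.
  rewrite mul_last_zeroE ?(ltW a0)// vecZE ler_wpM2r ?orbit_ge0//.
  by rewrite last_zero_le ?ltW.
apply/ler_addgt0Pr => e e0; rewrite add0r.
have P0 : 0 < p r s t0 + 1 by rewrite ltr_wpDl ?p_ge0.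
pose a := Num.min (b / 2) (e / (p r s t0 + 1)).
have a0 : 0 < a by rewrite lt_min !divr_gt0.
apply: (le_trans (mean_small a a0 _)).
  by rewrite gt_min; apply/orP; left; lra.
apply: (@le_trans _ _ (a * (p r s t0 + 1))).
  by rewrite ler_pM2l// lerDl.
by rewrite -ler_pdivlMr// ge_min lexx orbT.
Qed.

End mean_last_zero.

(** The mean being zero, every point [x] between [r] and [s] has last zero 0. *)
Lemma p_gt0_before r s t0 t : 0 < t <= t0 -> 0 < p r s t0 -> 0 < p r s t.
Proof.
move=> /andP[t0' tt0] pt0; pose b := t0 - t / 2.
have b0 : 0 < b by rewrite /b; lra.
have bt : b < t0 by rewrite /b; lra.
have tb0 : 0 < t0 - b by rewrite subr_gt0.
have [|x [prx pxs]] := @p_split r s b (t0 - b) b0 tb0.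
  by rewrite addrC subrK.
have avg := mean_le0 r s b0 bt.
have := @finite_sum_le _ _ _ [:: x] (mulv (last_zero r ^~ b) (T b (unit_vec E r))) s
  (T_positive tb0).
rewrite big_seq1 mul_last_zeroE ?(ltW b0)// => h.
have {h} : last_zero r x b * p r x b * p x s (t0 - b) <= 0.
  apply: (le_trans (h _ isT)) => // y.
  by rewrite mul_last_zeroE ?(ltW b0)// mulr_ge0 ?last_zero_ge0 ?orbit_ge0 ?(ltW b0).
rewrite pmulr_lle0// pmulr_lle0// => l0.
have {}l0 : last_zero r x b = 0.
  by apply/eqP; rewrite eq_le l0 last_zero_ge0// ltW.
have t2 : 0 < t / 2 by rewrite divr_gt0.
have prx2 : 0 < p r x (t / 2).
  by apply: (last_zero_eq0 l0); rewrite t2/= /b; lra.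
have := p_comp t2 tb0 prx2 pxs; congr (0 < p r s _); rewrite /b; lra.
Qed.

(** Suppose [p r s t = 0]. By [p_gt0_before] each [p r x] is positive exactly up
    to some time [c x]; this is finite for a point [x] between [r] and [s], and
    [c] increases by at least [u] along transitions in time [u]. Put
    [l = c x]. The points [y] with [c y <= l] at time [v + u] are thus reached
    from points with [c y <= l - u] at time [v], among which [x] is not: the
    mass [psi] of the set [N] of points with [c y <= l] drops at once by the
    mass of the paths through [x], which continuity on finite sets forbids. *)
Lemma p_gt0_after r s t0 t : 0 < t0 -> 0 < t -> 0 < p r s t0 -> 0 < p r s t.
Proof.
move=> t00 t0' pt0; rewrite lt_def p_ge0// andbT; apply/eqP => pt.
pose v := t0 / 2; have v0 : 0 < v by rewrite divr_gt0.
have tvE : t0 - v = v by rewrite /v; lra.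
have [|x [prx pxs]] := @p_split r s v v v0 v0; first by rewrite -{1}tvE subrK.
pose F := [set u | 0 < u /\ 0 < p r x u].
have Fub : ubound F t.
  move=> u [u0 pu]; rewrite leNgt; apply/negP => tu.
  have : 0 < p r s t.
    apply: (@p_gt0_before _ _ (u + v)); last exact: p_comp pu pxs.
    by rewrite t0'/=; lra.
  by rewrite pt ltxx.
have supF : has_sup F by split; [exists v|exists t].
pose l := sup F.
have vl : v <= l by apply: ub_le_sup; [case: supF|].
have l0 : 0 < l by exact: lt_le_trans vl.
have pl : p r x l = 0.
  apply/eqP; rewrite eq_le p_ge0// andbT leNgt; apply/negP => pl.
  have : \forall u \near (0 : R)^'+, False.
    near=> u.
    have u0 : 0 < u by near: u; exact: nbhs_right_gt.
    have : l + u <= l.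
      apply: ub_le_sup; first by case: supF.
      by split; [rewrite addr_gt0|near: u; exact: p_gt0_right].
    by lra.
  by move=> /filter_ex[].
have plu u : 0 < u -> u < l -> 0 < p r x (l - u).
  move=> u0 ul; have [w [w0 pw] lw] := sup_adherent u0 supF.
  by apply: (p_gt0_before _ pw); rewrite subr_gt0 ul ltW.
pose N y := p r y l == 0.
pose kill f := mulv (fun y => (N y)%:R) f.
have killE f y : kill f y = (N y)%:R * f y by exact: mulv_boolE.
pose psi w := T (t0 - w) (kill (T w (unit_vec E r))) s.
have kill_ge0 w : 0 < w -> forall y, 0 <= kill (T w (unit_vec E r)) y.
  by move=> w0 y; rewrite killE mulr_ge0// orbit_ge0.
have vt : v < t0 by rewrite /v; lra.
have tv0 : 0 < t0 - v by rewrite subr_gt0.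
have upper u : 0 < u -> v + u < t0 -> u < l ->
    psi (v + u) + p r x v * p x s (t0 - v) <= psi v.
  move=> u0 vut ul.
  have -> : psi v = p r x v * p x s (t0 - v) +
      T (t0 - v) (off [:: x] (kill (T v (unit_vec E r)))) s.
    rewrite /psi (@op_decomp _ _ (T (t0 - v)) [:: x])// big_seq1 killE.
    by rewrite /N pl eqxx mul1r.
  rewrite addrC lerD2l /psi.
  have -> : t0 - v = t0 - (v + u) + u by ring.
  have w0 : 0 < t0 - (v + u) by rewrite subr_gt0.
  rewrite [T (t0 - _ + u) _]T_semigroup//; apply: (positive_le (T_positive w0)) => y.
  rewrite killE; case: (boolP (N y)) => [/eqP Ny|_]; last first.
    rewrite mul0r; apply: T_positive => // z.
    by rewrite offE mulr_ge0// kill_ge0.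
  rewrite mul1r [v + u]addrC T_semigroup// -subr_le0 -opBE.
  apply: (positive_le0 (T_positive u0)) => z pzy.
  rewrite vecDE vecNE offE killE subr_le0 inE.
  (* A transition from [z] to [y] with [N y] forces [c z <= l - u]. *)
  have lu0 : 0 < l - u by rewrite subr_gt0.
  have pzlu : ~ 0 < p r z (l - u).
    move=> pz; have := p_comp lu0 u0 pz pzy.
    by rewrite subrK Ny ltxx.
  have -> : z != x by apply/eqP => zx; apply: pzlu; rewrite zx plu.
  have -> : N z.
    rewrite /N eq_le p_ge0// andbT leNgt; apply/negP => pz; apply: pzlu.
    by apply: (p_gt0_before _ pz); rewrite lu0/=; lra.
  by rewrite !mul1r.
pose a := p r x v * p x s (t0 - v).
have a0 : 0 < a by rewrite mulr_gt0// tvE.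
have a2 : 0 < a / 2 by rewrite divr_gt0.
have [K [uK K0 Ke]] := order_continuity s (T_positive tv0) (kill_ge0 v v0) a2.
have KN z : z \in K -> N z.
  by move=> /K0; rewrite killE; case: (N z) => //; rewrite mul0r ltxx.
have psi_v : psi v <= \sum_(x <- K) p r x v * p x s (t0 - v) + a / 2.
  rewrite /psi (op_decomp _ _ _ uK) lerD// big_seq [leRHS]big_seq ler_sum// => y yK.
  by rewrite killE KN// mul1r.
have psi_vu u : 0 < u -> v + u < t0 ->
    \sum_(x <- K) p r x (v + u) * p x s (t0 - (v + u)) <= psi (v + u).
  move=> u0 vut; have vu0 : 0 < v + u by rewrite addr_gt0.
  apply: (le_trans _ (@finite_sum_le _ _ _ K _ s _ (kill_ge0 _ vu0) uK)).
    by rewrite big_seq [leRHS]big_seq ler_sum// => y yK; rewrite killE KN// mul1r.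
  by apply: T_positive; rewrite subr_gt0.
have mass : \forall u \near (0 : R)^'+,
    \sum_(x <- K) p r x v * p x s (t0 - v) - a / 2 <
    \sum_(x <- K) p r x (v + u) * p x s (t0 - (v + u)).
  by apply: (cvgr_gt _ (@bridge_sum_right r s t0 v K v0 vt)); rewrite ltrBlDr ltrDl.
have : \forall u \near (0 : R)^'+, False.
  near=> u.
  have u0 : 0 < u by near: u; exact: nbhs_right_gt.
  have ut : u < t0 - v by near: u; exact: nbhs_right_lt.
  have ul : u < l by near: u; exact: nbhs_right_lt.
  have vut : v + u < t0 by lra.
  have mass_u : \sum_(x <- K) p r x v * p x s (t0 - v) - a / 2 <
    \sum_(x <- K) p r x (v + u) * p x s (t0 - (v + u)) by near: u.
  have := upper u u0 vut ul; have := psi_vu u u0 vut; rewrite -/a; lra.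
by move=> /filter_ex[].
Unshelve. all: by end_near. Qed.

Lemma countable_orbit_support f :
  countable [set r | exists2 t, 0 < t & 0 < `|T t f r|].
Proof.
apply: (@sub_countable _ _ _ (\bigcup_(q : rat) [set r | T (ratr q) f r != 0])).
  apply: subset_card_le => r [t t0]; rewrite normr_gt0 => Tr.
  have norm_cvg : (fun u => `|T u f r|) @ t --> `|T t f r|.
    by apply: cvg_norm; exact: orbit_cvg.
  have : \forall u \near t, 0 < `|T u f r|.
    by apply: (cvgr_gt _ norm_cvg); rewrite normr_gt0.
  move=> [d /= d0 hd].
  have /rat_in_itvoo[q] : t < t + d by rewrite ltrDl.
  rewrite in_itv/= => /andP[tq qtd]; exists q => //=.
  rewrite -normr_gt0; apply: hd => /=.
  by rewrite distrC gtr0_norm ?subr_gt0//; lra.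
apply: bigcup_countable => [|q _]; first exact: countableP.
exact: countable_support.
Qed.

End semigroup.

Theorem corollary3p5 (R : realType) (E : fspace R)
    (T : R -> {linear vec E -> vec E})
    (T_semigroup : forall t s : R, 0 < t -> 0 < s ->
      forall f : vec E, T (t + s) f = T t (T s f))
    (T_positive : forall t : R, 0 < t -> forall f : vec E,
      (forall r : R, 0 <= f r) -> forall r : R, 0 <= T t f r)
    (T_continuous : forall f : vec E,
      {within `]0, +oo[, continuous (fun t : R => T t f)}) :
  (forall f : vec E, countable [set r | exists2 t : R, 0 < t & 0 < `|T t f r|]) /\
  (forall r s : R,
    (forall t : R, 0 < t -> 0 < T t (unit_vec E r) s) \/
    (forall t : R, 0 < t -> T t (unit_vec E r) s = 0)).
Proof.
split=> [f|r s]; first exact: countable_orbit_support.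
have [[t [t0 pt]]|none] :=
  pselect (exists t, 0 < t /\ 0 < T t (unit_vec E r) s).
  left=> t' t'0; exact: (p_gt0_after T_semigroup T_positive T_continuous t0 t'0 pt).
right=> t t0; apply/eqP; rewrite eq_le (p_ge0 T_positive)// andbT leNgt.
by apply/negP => pt; apply: none; exists t.
Qed.
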